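(* There exists a positive quantum graph $x \in \mathcal{A}_{\emptyset}$ which cannot be expressed as a sum of squares, i.e. there are no finitely many $g_1,\ldots,g_m \in \mathcal{A}$ with $x = \llbracket \sum_{i=1}^m g_i^2 \rrbracket$.
   Context: All graphs are finite and simple; $\emptyset$ denotes the graph with no vertices. For graphs $H,G$, $t(H;G)$ is the probability that a uniformly random map $V(H)\to V(G)$ is a homomorphism (sends edges to edges); $t(\emptyset;G)=1$. A partially labeled graph is a graph in which some vertices carry distinct positive-integer labels (the remaining vertices are unlabeled). $\mathcal{F}$ is the set of partially labeled graphs up to label-preserving isomorphism, and for a finite $L\subset\mathbb{N}$, $\mathcal{F}_L$ is the set of those whose set of labels is exactly $L$. The product $H_1\cdot H_2$ of partially labeled graphs is obtained by taking the disjoint union and identifying vertices with the same label (keeping only one copy of any multiple edge). $\mathbb{R}[\mathcal{F}]$ is the algebra of finite formal real linear combinations of elements of $\mathcal{F}$ with this product extended bilinearly; $\mathbb{R}[\mathcal{F}_L]$ is its subalgebra spanned by $\mathcal{F}_L$; elements of $\mathbb{R}[\mathcal{F}_\emptyset]$ are called quantum graphs. For $H\in\mathcal{F}_L$, a graph $G$ and $\phi:L\to V(G)$, $t(H;G,\phi)$ is the probability that the map $V(H)\to V(G)$ sending each labeled vertex with label $\ell$ to $\phi(\ell)$ and each unlabeled vertex to an independent uniformly random vertex of $G$ is a homomorphism. For $f=\sum_i\alpha_iH_i$ with $L_i$ the label set of $H_i$ and $\phi:\bigcup_i L_i\to V(G)$, $t(f;G,\phi):=\sum_i\alpha_i t(H_i;G,\phi|_{L_i})$.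 Let $\mathcal{K}$ be the ideal of $\mathbb{R}[\mathcal{F}]$ generated by the elements $F-\emptyset$ with $F$ a one-vertex (labeled or unlabeled) graph; set $\mathcal{A}=\mathbb{R}[\mathcal{F}]/\mathcal{K}$ and $\mathcal{A}_L=\mathbb{R}[\mathcal{F}_L]/(\mathcal{K}\cap\mathbb{R}[\mathcal{F}_L])$; $t(\cdot;G,\phi)$ is well defined on these quotients. An element $f\in\mathcal{A}_L$ is positive if $t(f;G,\phi)\ge 0$ for every graph $G$ and every $\phi:L\to V(G)$. For finite $T\subset\mathbb{N}$, $\llbracket\cdot\rrbracket_T$ is the linear map on $\mathbb{R}[\mathcal{F}]$ (and on $\mathcal{A}$) that removes all labels not in $T$ (those vertices become unlabeled); $\llbracket\cdot\rrbracket:=\llbracket\cdot\rrbracket_\emptyset$. *)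

(* Defs.v *)
From HB Require Import structures.
From mathcomp Require Import all_boot all_order all_algebra.
From mathcomp Require Import Rstruct.
Set Implicit Arguments. Unset Strict Implicit. Unset Printing Implicit Defensive.
Import Order.TTheory GRing.Theory Num.Theory.
Local Open Scope ring_scope.

(* ---------- Partially labeled graphs ----------
   A partially labeled graph H has labeled vertices [inl l] for l in [labs H]
   and unlabeled vertices [inr k] for k < [nu H].  [adj H] is the adjacency
   relation; only its restriction to the vertex set matters. *)
Record plg := PLG {
  labs : seq nat;
  nu : nat;
  adj : (nat + nat)%type -> (nat + nat)%type -> bool }.

Definition vtx (H : plg) : finType := ('I_(size (labs H)) + 'I_(nu H))%type.

Definition emb (H : plg) (x : vtx H) : (nat + nat)%type :=
  match x with inl i => inl (nth 0%N (labs H) i) | inr k => inr (val k) end.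

Definition lab (H : plg) (x : vtx H) : option nat :=
  match x with inl i => Some (nth 0%N (labs H) i) | inr _ => None end.

Definition edge (H : plg) (x y : vtx H) : bool := adj H (emb x) (emb y).

Definition wf (H : plg) : bool :=
  [&& uniq (labs H), all (fun l => 0 < l)%N (labs H),
      [forall x : vtx H, ~~ edge x x] &
      [forall x : vtx H, forall y : vtx H, edge x y == edge y x]].

Definition iso (H H' : plg) : bool :=
  (#|vtx H| == #|vtx H'|)%N &&
  [exists f : {ffun vtx H -> vtx H'},
     [&& injectiveb f,
         [forall x, lab (f x) == lab x] &
         [forall x, forall y, edge (f x) (f y) == edge x y]]].

Definition empty_plg : plg := PLG [::] 0 (fun _ _ => false).

Definition one_vertex (H : plg) : bool := (size (labs H) + nu H == 1)%N.

(* product: disjoint union, identifying equally labeled vertices *)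
Definition restr1 (H1 : plg) (v : (nat + nat)%type) : option (nat + nat) :=
  match v with
  | inl l => if l \in labs H1 then Some (inl l) else None
  | inr k => if (k < nu H1)%N then Some (inr k) else None
  end.

Definition restr2 (H1 H2 : plg) (v : (nat + nat)%type) : option (nat + nat) :=
  match v with
  | inl l => if l \in labs H2 then Some (inl l) else None
  | inr k => if (nu H1 <= k)%N && (k < nu H1 + nu H2)%N
             then Some (inr (k - nu H1)%N) else None
  end.

Definition gprod (H1 H2 : plg) : plg :=
  PLG (undup (labs H1 ++ labs H2)) (nu H1 + nu H2)
    (fun u v =>
       (match restr1 H1 u, restr1 H1 v with
        | Some a, Some b => adj H1 a b | _, _ => false end) ||
       (match restr2 H1 H2 u, restr2 H1 H2 v with
        | Some a, Some b => adj H2 a b | _, _ => false end)).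

(* [[H]] : remove all labels (labeled vertices become unlabeled vertices
   nu H, nu H + 1, ...) *)
Definition unl_back (H : plg) (v : (nat + nat)%type) : (nat + nat)%type :=
  match v with
  | inl l => inl l
  | inr k => if (k < nu H)%N then inr k else inl (nth 0%N (labs H) (k - nu H))
  end.

Definition unl (H : plg) : plg :=
  PLG [::] (nu H + size (labs H))
      (fun u v => adj H (unl_back H u) (unl_back H v)).

Definition comb := seq (Rdefinitions.R * plg)%type.

Definition wfc (f : comb) : Prop := forall p, List.In p f -> wf p.2.
Definition unlabeled_comb (f : comb) : Prop := forall p, List.In p f -> labs p.2 = [::].

Definition coef (f : comb) (H : plg) : Rdefinitions.R := \sum_(p <- f | iso p.2 H) p.1.

Definition eqF (f g : comb) : Prop := forall H, coef f H = coef g H.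

Definition cadd (f g : comb) : comb := f ++ g.
Definition cscale (c : Rdefinitions.R) (f : comb) : comb := [seq (c * p.1, p.2) | p <- f].
Definition csub (f g : comb) : comb := cadd f (cscale (-1) g).
Definition cmul (f g : comb) : comb :=
  [seq (p.1 * q.1, gprod p.2 q.2) | p <- f, q <- g].
Definition cunl (f : comb) : comb := [seq (p.1, unl p.2) | p <- f].
Definition csum (fs : seq comb) : comb := flatten fs.

Definition inK (f : comb) : Prop :=
  exists hs : seq (comb * plg),
    (forall h, List.In h hs -> wfc h.1 /\ wf h.2 /\ one_vertex h.2) /\
    eqF f (csum [seq cmul h.1 [:: (1, h.2); (-1, empty_plg)] | h <- hs]).

(* equality in A = R[F]/K *)
Definition eqA (f g : comb) : Prop := inK (csub f g).

(* G = (T, e) a finite simple graph; phi : labels -> V(G) *)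
Definition hom_map (T : finType) (phi : nat -> T) (H : plg)
    (psi : {ffun 'I_(nu H) -> T}) (x : vtx H) : T :=
  match x with inl i => phi (nth 0%N (labs H) i) | inr k => psi k end.

Definition tH (T : finType) (e : rel T) (phi : nat -> T) (H : plg) : Rdefinitions.R :=
  (#|[pred psi : {ffun 'I_(nu H) -> T} |
       [forall x : vtx H, forall y : vtx H,
          edge x y ==> e (hom_map phi psi x) (hom_map phi psi y)]]|%:R)
  / ((#|T| ^ nu H)%N%:R).

Definition tc (T : finType) (e : rel T) (phi : nat -> T) (f : comb) : Rdefinitions.R :=
  \sum_(p <- f) p.1 * tH e phi p.2.

Definition positive0 (f : comb) : Prop :=
  forall (T : finType) (e : rel T), symmetric e -> irreflexive e ->
    forall phi : nat -> T, 0 <= tc e phi f.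

Definition is_sos (f : comb) : Prop :=
  exists gs : seq comb, (forall g, List.In g gs -> wfc g) /\
    eqA f (cunl (csum [seq cmul g g | g <- gs])).

(* Main.v *)
Require Import Defs.
From mathcomp Require Import all_boot all_order all_algebra.
From mathcomp Require Import Rstruct zify ring lra.
Set Implicit Arguments. Unset Strict Implicit. Unset Printing Implicit Defensive.
Import Order.TTheory GRing.Theory Num.Theory.

(** The witness is the Blakley-Roy inequality [P - e^3 >= 0], where [P] is the
    path with three edges and [e^3] the disjoint union of three edges.

    Positivity: with [l] the average degree, sum over all edges [uv] the AM-GM
    inequality [3 l^2 <= d_u d_v + l^3 / d_u + l^3 / d_v].

    Not a sum of squares: call the order of a partially labeled graph the number
    of its edges between labels plus twice the number of its other edges.  In
    [[g^2]], the part with few edges only comes from the terms of [g] of low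
    order, because a product [F1 F2] in which both factors have order at least
    [d] has at least [d] edges, with equality only if both have order [d] and
    the same labeled edges.  Suitable functionals, supported on the graphs with
    0, 1 and 2 edges, show successively that the terms of [g] of order 0, 1 and
    2 cancel; then a functional [L] on the graphs with 3 edges, which depends on
    the sum of the squared degrees only, satisfies [L [[g^2]] >= 0].  Since
    [L P = 0] and [L e^3 = 1], the difference is not a sum of squares. *)

(** * Edge count and squared degrees as isomorphism invariants *)

Notation R := Rdefinitions.R.

(* Ordered pairs are counted: this is twice the number of edges. *)
Definition edges2 (H : plg) : nat := \sum_(x : vtx H) \sum_(y : vtx H) edge x y.
Definition degsq (H : plg) : nat :=
  \sum_(x : vtx H) (\sum_(y : vtx H) edge x y) ^ 2.

(** Labels need not match, so this applies to isomorphisms and to the removal of labels alike. *)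
Lemma edge_bij_stats (H H' : plg) (f : vtx H -> vtx H') : bijective f ->
  (forall x y, edge (f x) (f y) = edge x y) ->
  edges2 H' = edges2 H /\ degsq H' = degsq H.
Proof.
move=> bf ef; have dE x : \sum_y edge (f x) y = \sum_y edge x y.
  by rewrite (reindex f) /=; [apply: eq_bigr => y _; rewrite ef|apply: onW_bij].
by rewrite /edges2 /degsq; split; rewrite (reindex f) /=;
  try exact: onW_bij; apply: eq_bigr => x _; rewrite dE.
Qed.

Lemma isoP (H H' : plg) :
  reflect (exists f : vtx H -> vtx H', [/\ bijective f,
     forall x, lab (f x) = lab x & forall x y, edge (f x) (f y) = edge x y])
    (iso H H').
Proof.
apply: (iffP andP) => [[/eqP cE /existsP [f /and3P [/injectiveP fi fl fe]]]|].
  exists f; split; first by apply: inj_card_bij => //; rewrite cE.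
    by move=> x; apply/eqP; move/forallP: fl.
  by move=> x y; apply/eqP; move/forallP: fe => /(_ x) /forallP.
move=> [f [bf fl fe]]; split; first by rewrite (bij_eq_card bf).
apply/existsP; exists [ffun x => f x]; apply/and3P; split.
- by apply/injectiveP => x y; rewrite !ffunE; apply: (bij_inj bf).
- by apply/forallP => x; rewrite ffunE fl.
- by apply/forallP => x; apply/forallP => y; rewrite !ffunE fe.
Qed.

Lemma iso_refl H : iso H H.
Proof. by apply/isoP; exists id; split => //; exists id. Qed.

Lemma iso_sym H H' : iso H H' -> iso H' H.
Proof.
move=> /isoP [f [[g fg gf] fl fe]]; apply/isoP; exists g; split.
- by exists f.
- by move=> x; rewrite -fl gf.
- by move=> x y; rewrite -fe !gf.
Qed.

Lemma iso_trans H H' H'' : iso H H' -> iso H' H'' -> iso H H''.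
Proof.
move=> /isoP [f [bf fl fe]] /isoP [g [bg gl ge]]; apply/isoP; exists (g \o f).
split; first exact: bij_comp.
- by move=> x /=; rewrite gl fl.
- by move=> x y /=; rewrite ge fe.
Qed.

Lemma iso_stats H H' : iso H H' -> edges2 H = edges2 H' /\ degsq H = degsq H'.
Proof. by move=> /isoP [f [bf _ fe]]; have [-> ->] := edge_bij_stats bf fe. Qed.

Lemma unl_stats (H : plg) : edges2 (unl H) = edges2 H /\ degsq (unl H) = degsq H.
Proof.
pose f (x : vtx H) : vtx (unl H) :=
  match x with inl i => inr (rshift (nu H) i) | inr k => inr (lshift _ k) end.
pose g (y : vtx (unl H)) : vtx H :=
  match y with
  | inl i => match (notF (ltn_ord i)) return vtx H with end
  | inr z => match split z with inl k => inr k | inr i => inl i end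
  end.
apply: (@edge_bij_stats _ _ f).
  exists g.
    by move=> [i|k]; rewrite /g /f ?(unsplitK (inr _)) ?(unsplitK (inl _)).
  move=> [[] //|z]; rewrite /g /f -{2}(splitK z).
  by case: (split z).
have fE x : unl_back H (emb (f x)) = emb x.
  case: x => [i|k] /=; last by rewrite ltn_ord.
  by rewrite ltnNge leq_addr /= addKn.
by move=> x y; rewrite /edge /= !fE.
Qed.

(** * Edges under raw vertex names, and profiles *)

Definition in_vtx (H : plg) (v : nat + nat) : bool :=
  match v with inl l => l \in labs H | inr k => k < nu H end.

(* [adj] is arbitrary outside the vertex set, hence the guards. *)
Definition cedge (H : plg) (u v : nat + nat) : bool :=
  [&& in_vtx H u, in_vtx H v & adj H u v].

Lemma in_vtx_emb (H : plg) (x : vtx H) : in_vtx H (emb x).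
Proof. by case: x => [i|k] /=; rewrite ?mem_nth. Qed.

Lemma edgeE (H : plg) (x y : vtx H) : edge x y = cedge H (emb x) (emb y).
Proof. by rewrite /cedge !in_vtx_emb. Qed.

Lemma emb_surj (H : plg) v : in_vtx H v -> exists x : vtx H, emb x = v.
Proof.
case: v => [l|k] /= hl; last by exists (inr (Ordinal hl)).
move: (hl); rewrite -index_mem => hi.
by exists (inl (Ordinal hi)); rewrite /= nth_index.
Qed.

Lemma cedge_sym (H : plg) u v : wf H -> cedge H u v = cedge H v u.
Proof.
move=> /and4P [_ _ _ /forallP hs].
case hu: (in_vtx H u); last by rewrite /cedge hu /= andbF.
case hv: (in_vtx H v); last by rewrite /cedge hv /= andbF.
have [x <-] := emb_surj hu; have [y <-] := emb_surj hv.
by rewrite -!edgeE; move/forallP: (hs x) => /(_ y) /eqP.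
Qed.

Lemma cedge_irr (H : plg) u : wf H -> cedge H u u = false.
Proof.
move=> /and4P [_ _ /forallP hs _]; case hu: (in_vtx H u); last by rewrite /cedge hu.
have [x <-] := emb_surj hu; rewrite -edgeE; exact/negbTE.
Qed.

Definition labs_lt (N : nat) (H : plg) := all (fun l => l < N) (labs H).

(** Names below [N] that are not labels of [H] contribute 0. The index type on the right is
    independent of the label set, which makes graphs with different labels comparable. *)
Lemma sum_vtx N (H : plg) (G : nat + nat -> nat) :
  uniq (labs H) -> labs_lt N H -> (forall u, ~~ in_vtx H u -> G u = 0) ->
  \sum_(x : vtx H) G (emb x) =
  \sum_(x : 'I_N + 'I_(nu H)) G (match x with inl l => inl (val l) | inr k => inr (val k) end).
Proof.
move=> ul /allP lN G0; rewrite !big_sumType /=; congr (_ + _).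
rewrite (bigID (fun l : 'I_N => val l \in labs H)) /= [X in _ + X]big1 ?addn0; last first.
  by move=> i hi; apply: G0.
rewrite -(big_mkord xpredT (fun i => G (inl (nth 0 (labs H) i)))).
rewrite -(big_nth 0 xpredT (fun l => G (inl l))).
rewrite -(big_mkord (fun l => l \in labs H) (fun l => G (inl l))).
rewrite -[RHS]big_filter; apply: perm_big; apply: uniq_perm => //.
  by rewrite filter_uniq // iota_uniq.
move=> l; rewrite mem_filter mem_index_iota /=.
by case hl: (l \in labs H) => //=; rewrite lN.
Qed.

(* The data of a partially labeled graph with labels below [N] that determine
   the statistics of all its products: the edges between labels (as ordered
   pairs), the number of the other ordered edges, the number of unlabeled
   neighbors of each label, and the sum of the squared degrees of the unlabeled
   vertices. *)
Record profile (N : nat) := Profile {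
  lset : {set 'I_N * 'I_N};
  wgt : nat;
  pend : {ffun 'I_N -> nat};
  usq : nat }.

Definition ldeg N (S : {set 'I_N * 'I_N}) (l : 'I_N) : nat :=
  \sum_(m : 'I_N) ((l, m) \in S).

Definition pedges N (p : profile N) : nat := #|lset p| + wgt p.
Definition pdegsq N (p : profile N) : nat :=
  \sum_l (ldeg (lset p) l + pend p l) ^ 2 + usq p.

Definition pjoin N (p q : profile N) : profile N :=
  Profile (lset p :|: lset q) (wgt p + wgt q)
    [ffun l => pend p l + pend q l] (usq p + usq q).

Definition pendants (H : plg) (u : nat + nat) : nat :=
  \sum_(k < nu H) cedge H u (inr (val k)).

Definition udeg N (H : plg) (k : nat) : nat :=
  \sum_(l < N) cedge H (inr k) (inl (val l)) + pendants H (inr k).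

Definition profile_of N (H : plg) : profile N :=
  Profile [set ij : 'I_N * 'I_N | cedge H (inl (val ij.1)) (inl (val ij.2))]
    (\sum_(l < N) pendants H (inl (val l)) + \sum_(k < nu H) udeg N H k)
    [ffun l : 'I_N => pendants H (inl (val l))]
    (\sum_(k < nu H) udeg N H k ^ 2).

Lemma sum_ldeg N (S : {set 'I_N * 'I_N}) : \sum_l ldeg S l = #|S|.
Proof.
rewrite /ldeg (pair_bigA _ (fun l m => ((l, m) \in S) : nat)) /= -sum1_card.
by rewrite [RHS]big_mkcond; apply: eq_bigr => -[l m] _ /=; case: (_ \in S).
Qed.

Lemma profile_stats N (H : plg) : uniq (labs H) -> labs_lt N H ->
  edges2 H = pedges (profile_of N H) /\ degsq H = pdegsq (profile_of N H).
Proof.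
move=> ul lN.
have dE u : \sum_(y : vtx H) cedge H u (emb y) =
    \sum_(l < N) cedge H u (inl (val l)) + pendants H u.
  rewrite (@sum_vtx N _ (fun v => cedge H u v)) ?big_sumType //.
  by move=> v /negbTE hv; rewrite /cedge hv andbF.
have d0 u : ~~ in_vtx H u ->
    \sum_(l < N) cedge H u (inl (val l)) + pendants H u = 0.
  by move=> /negbTE hu; rewrite /pendants /cedge hu /= !big1.
split.
  rewrite /edges2 /pedges /=.
  under eq_bigr => x _ do
    (under eq_bigr => y _ do rewrite edgeE); under eq_bigr => x _ do rewrite dE.
  rewrite (sum_vtx (N:=N) (G:=fun u => \sum_(l < N) cedge H u (inl (val l)) + pendants H u)) //.
  rewrite big_sumType /= big_split /= -addnA; congr (_ + _).
  rewrite -sum_ldeg; apply: eq_bigr => l _; apply: eq_bigr => m _.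
  by rewrite inE.
rewrite /degsq /pdegsq /=.
under eq_bigr => x _ do
  (under eq_bigr => y _ do rewrite edgeE); under eq_bigr => x _ do rewrite dE.
rewrite (sum_vtx (N:=N) (G:=fun u => (\sum_(l < N) cedge H u (inl (val l)) + pendants H u)^2)) //;
  last by move=> u /d0 ->.
rewrite big_sumType /=; congr (_ + _); apply: eq_bigr => l _.
by rewrite ffunE; congr ((_ + _) ^ _); apply: eq_bigr => m _; rewrite inE.
Qed.

(** * Profiles of products *)

Lemma cedge_gprod_ll F1 F2 i j : cedge (gprod F1 F2) (inl i) (inl j) =
  cedge F1 (inl i) (inl j) || cedge F2 (inl i) (inl j).
Proof.
rewrite /cedge /= !mem_undup !mem_cat.
by case: (i \in labs F1) (i \in labs F2) (j \in labs F1) (j \in labs F2) => [] [] [] [] /=;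
  rewrite ?orbF ?andbF.
Qed.

Lemma cedge_gprod_lshift F1 F2 (k : nat) (v : nat + nat) : k < nu F1 ->
  match v with inl _ => true | inr m => m < nu F1 end ->
  cedge (gprod F1 F2) v (inr k) = cedge F1 v (inr k) /\
  cedge (gprod F1 F2) (inr k) v = cedge F1 (inr k) v.
Proof.
move=> hk; have hk' : (nu F1 <= k) = false by rewrite leqNgt hk.
have hk2 : k < nu F1 + nu F2 by apply: (leq_trans hk); rewrite leq_addr.
rewrite /cedge; case: v => [l _|m hm] /=; rewrite ?mem_undup ?mem_cat hk hk' hk2 /=.
  by case: (l \in labs F1) (l \in labs F2) => [] []; rewrite /= ?orbF ?andbF.
have hm' : (nu F1 <= m) = false by rewrite leqNgt hm.
have hm2 : m < nu F1 + nu F2 by apply: (leq_trans hm); rewrite leq_addr.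
by rewrite hm hm' hm2 /= !orbF.
Qed.

Lemma cedge_gprod_rshift F1 F2 (k : nat) (v w : nat + nat) : k < nu F2 ->
  match v, w with inl l, inl m => l = m
    | inr n, inr m => n = nu F1 + m /\ m < nu F2 | _, _ => False end ->
  cedge (gprod F1 F2) v (inr (nu F1 + k)) = cedge F2 w (inr k) /\
  cedge (gprod F1 F2) (inr (nu F1 + k)) v = cedge F2 (inr k) w.
Proof.
move=> hk; have hk' : (nu F1 + k < nu F1) = false by rewrite ltnNge leq_addr.
rewrite /cedge; case: v w => [l|n] [m|m] //=.
  move=> <-; rewrite mem_undup mem_cat ltn_add2l hk hk' leq_addr addKn /=.
  by case: (l \in labs F1) (l \in labs F2) => [] [].
move=> [-> hm]; have hm' : (nu F1 + m < nu F1) = false by rewrite ltnNge leq_addr.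
by rewrite !ltn_add2l hm hk hk' hm' !leq_addr !addKn.
Qed.

Lemma cedge_gprod_lr F1 F2 (k m : nat) : k < nu F1 -> m < nu F2 ->
  cedge (gprod F1 F2) (inr k) (inr (nu F1 + m)) = false /\
  cedge (gprod F1 F2) (inr (nu F1 + m)) (inr k) = false.
Proof.
move=> hk hm; rewrite /cedge /=.
have -> : (nu F1 + m < nu F1) = false by rewrite ltnNge leq_addr.
have -> : (nu F1 <= k) = false by rewrite leqNgt hk.
by rewrite hk ltn_add2l hm leq_addr /= !andbF.
Qed.

(** An edge between labels may occur in both factors and is kept once, hence the union. Every other
    edge has an unlabeled end, which belongs to one factor only, so the remaining data add up. *)
Lemma profile_gprod N F1 F2 :
  profile_of N (gprod F1 F2) = pjoin (profile_of N F1) (profile_of N F2).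
Proof.
have lE (l : nat) : pendants (gprod F1 F2) (inl l) =
    pendants F1 (inl l) + pendants F2 (inl l).
  rewrite /pendants big_split_ord /=; congr (_ + _); apply: eq_bigr => k _ /=.
    by have [->] := @cedge_gprod_lshift F1 F2 k (inl l) (ltn_ord k) isT.
  by have [->] := @cedge_gprod_rshift F1 F2 k (inl l) (inl l) (ltn_ord k) erefl.
have u1 (k : 'I_(nu F1)) : udeg N (gprod F1 F2) k = udeg N F1 k.
  rewrite /udeg /pendants big_split_ord /=; congr (_ + _).
    apply: eq_bigr => l _.
    by have [_ ->] := @cedge_gprod_lshift F1 F2 k (inl (val l)) (ltn_ord k) isT.
  rewrite [X in _ + X]big1 ?addn0; last first.
    by move=> m _; have [->] := cedge_gprod_lr (ltn_ord k) (ltn_ord m).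
  apply: eq_bigr => m _.
  by have [_ ->] := @cedge_gprod_lshift F1 F2 k (inr (val m)) (ltn_ord k) (ltn_ord m).
have u2 (k : 'I_(nu F2)) : udeg N (gprod F1 F2) (nu F1 + k) = udeg N F2 k.
  rewrite /udeg /pendants big_split_ord /=; congr (_ + _).
    apply: eq_bigr => l _.
    by have [_ ->] := @cedge_gprod_rshift F1 F2 k (inl (val l)) (inl (val l)) (ltn_ord k) erefl.
  rewrite [X in X + _]big1 ?add0n; last first.
    by move=> m _; have [_ ->] := cedge_gprod_lr (ltn_ord m) (ltn_ord k).
  apply: eq_bigr => m _.
  by have [_ ->] := @cedge_gprod_rshift F1 F2 k (inr (nu F1 + m)) (inr (val m))
    (ltn_ord k) (conj erefl (ltn_ord m)).
rewrite /profile_of /pjoin /=; congr Profile.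
- by apply/setP => -[i j]; rewrite !inE /= cedge_gprod_ll.
- under eq_bigr => l _ do rewrite lE.
  rewrite big_split /= big_split_ord /= addnACA; congr ((_ + _) + (_ + _)).
    by apply: eq_bigr => k _; apply: u1.
  by apply: eq_bigr => k _; apply: u2.
- by apply/ffunP => l; rewrite !ffunE lE.
- rewrite big_split_ord /=; congr (_ + _); apply: eq_bigr => k _.
    by rewrite u1.
  by rewrite u2.
Qed.

(** * Parity and order of profiles *)

Lemma card_sym_irr_even (T : finType) (r : rel T) : symmetric r -> irreflexive r ->
  ~~ odd (\sum_x \sum_y r x y).
Proof.
move=> rs ri.
have -> : \sum_x \sum_y r x y =
    \sum_x \sum_y (if enum_rank x < enum_rank y then r x y : nat else 0) +
    \sum_x \sum_y (if enum_rank y < enum_rank x then r x y : nat else 0).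
  rewrite -big_split; apply: eq_bigr => x _; rewrite -big_split; apply: eq_bigr => y _ /=.
  case: ltngtP => h; rewrite ?addn0 ?add0n //.
  by move/ord_inj/enum_rank_inj: h => ->; rewrite ri.
rewrite [X in _ + X]exchange_big /=.
set a := \sum_x _; set b := \sum_x _; suff -> : b = a by rewrite addnn odd_double.
by apply: eq_bigr => x _; apply: eq_bigr => y _; rewrite rs.
Qed.

(** A vertex of degree at least 2 has a neighbor of positive degree, so the degree sum would be at
    least 3. Hence all degrees are 0 or 1 and equal their squares. *)
Lemma sum_sq_deg_one_edge (T : finType) (r : rel T) : symmetric r -> irreflexive r ->
  \sum_x \sum_y r x y = 2 -> \sum_x (\sum_y r x y) ^ 2 = 2.
Proof.
move=> rs ri; pose d x := \sum_y r x y; rewrite -/(\sum_x d x) => h2.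
have d1 x : d x <= 1.
  rewrite leqNgt; apply/negP => dx.
  have [y hy] : exists y, r x y.
    case: (pickP (r x)) => [y hy|h0]; first by exists y.
    by move: dx; rewrite /d big1 // => y _; rewrite h0.
  have nxy : y != x by apply/eqP => e; rewrite e ri in hy.
  have dy : 0 < d y by rewrite /d (bigD1 x) //= rs hy.
  by move: h2; rewrite (bigD1 x) //= (bigD1 y) //=; lia.
rewrite -[RHS]h2; apply: eq_bigr => x _; rewrite -/(d x).
by have := d1 x; case: (d x) => [|[|[]]].
Qed.

(** The last field describes a single edge outside the labeled part: it is free, with [usq p = 2],
    or attached to one label, with [usq p = 1]. *)
Record valid N (p : profile N) : Prop := Valid {
  val_sym : forall i j, ((i, j) \in lset p) = ((j, i) \in lset p);
  val_irr : forall i, (i, i) \notin lset p;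
  val_wgt : ~~ odd (wgt p);
  val_wgt0 : wgt p = 0 -> pend p = [ffun=> 0] /\ usq p = 0;
  val_wgt2 : wgt p = 2 -> \sum_l pend p l <= 1 /\
               usq p + \sum_l pend p l ^ 2 = 2 }.

Lemma valid_profile N H : wf H -> valid (profile_of N H).
Proof.
move=> wH.
pose code (x : 'I_N + 'I_(nu H)) : nat + nat :=
  match x with inl l => inl (val l) | inr k => inr (val k) end.
(* This is [H] without its edges between labels; its degree sum is [wgt]. *)
pose r : rel ('I_N + 'I_(nu H)) := fun x y =>
  match x, y with inl _, inl _ => false | _, _ => cedge H (code x) (code y) end.
have rs : symmetric r by move=> [i|k] [j|m]; rewrite //= cedge_sym.
have ri : irreflexive r by move=> [i|k]; rewrite //= cedge_irr.
have dl l : \sum_y r (inl l) y = pendants H (inl (val l)).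
  by rewrite big_sumType /= big1 ?add0n.
have dr k : \sum_y r (inr k) y = udeg N H k by rewrite big_sumType.
have rE : \sum_x \sum_y r x y = wgt (profile_of N H).
  by rewrite big_sumType /=; congr (_ + _); apply: eq_bigr => ? _; rewrite ?dl ?dr.
(* Each edge from a label to an unlabeled vertex is counted again from its unlabeled end, so these
   edges account for at most half of [wgt] on the label side. *)
have le : \sum_(l < N) pendants H (inl (val l)) <= \sum_(k < nu H) udeg N H k.
  rewrite /pendants exchange_big /=; apply: leq_sum => k _.
  rewrite /udeg; apply: leq_trans (leq_addr _ _); apply: leq_sum => l _.
  by rewrite cedge_sym.
split.
- by move=> i j; rewrite !inE cedge_sym.
- by move=> i; rewrite inE cedge_irr.
- by rewrite -rE card_sym_irr_even.
- move=> /= /eqP; rewrite addn_eq0 !sum_nat_eq0 => /andP [/forallP h1 /forallP h2]; split.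
    by apply/ffunP => l; rewrite !ffunE; exact/eqP/(h1 l).
  by apply: big1 => k _; rewrite (eqP (h2 k)).
- move=> h; have pE : \sum_l pend (profile_of N H) l = \sum_(l < N) pendants H (inl (val l)).
    by apply: eq_bigr => l _; rewrite ffunE.
  split; first by move: h le; rewrite pE /=; lia.
  rewrite -[RHS](sum_sq_deg_one_edge rs ri) ?rE // big_sumType /= addnC.
  by congr (_ + _); apply: eq_bigr => ? _; rewrite ?ffunE ?dl ?dr.
Qed.

Lemma lset_even N (p : profile N) : valid p -> ~~ odd #|lset p|.
Proof.
move=> vp; rewrite -sum_ldeg.
apply: (card_sym_irr_even (r := fun i j => (i, j) \in lset p)) => [i j|i].
  exact: val_sym.
exact/negbTE/val_irr.
Qed.

(* Twice the order, since edges are counted as ordered pairs. *)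
Definition pord N (p : profile N) : nat := #|lset p| + (wgt p).*2.

Lemma pord_even N (p : profile N) : valid p -> ~~ odd (pord p).
Proof. by move=> vp; rewrite oddD odd_double addbF lset_even. Qed.

(** Twice the size of a union is at least the sum of the two sizes, so twice the edge count of the
    product is at least [pord p + pord q]. Equality forces the union to be no larger than either
    set. *)
Lemma pedges_pjoin N (p q : profile N) (d : nat) : d <= pord p -> d <= pord q ->
  (pedges (pjoin p q) == d) =
  [&& lset p == lset q, pord p == d & pord q == d].
Proof.
rewrite /pord /pedges /= => hp hq.
have s1 := subset_leq_card (subsetUl (lset p) (lset q)).
have s2 := subset_leq_card (subsetUr (lset p) (lset q)).
apply/eqP/and3P; last first.
  move=> [/eqP e]; rewrite -e setUid.
  by move: #|lset p| => a /eqP e1 /eqP e2; lia.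
move=> e.
have [c1 c2 e1 e2] : [/\ #|lset p :|: lset q| <= #|lset p|,
    #|lset p :|: lset q| <= #|lset q|,
    #|lset p| + (wgt p).*2 = d & #|lset q| + (wgt q).*2 = d].
  move: e s1 s2 hp hq.
  by move: #|lset p :|: lset q| #|lset p| #|lset q| => a b c; split; lia.
split; try exact/eqP.
have u1 : lset p = lset p :|: lset q.
  by apply/eqP; rewrite eqEcard subsetUl.
have u2 : lset q = lset p :|: lset q.
  by apply/eqP; rewrite eqEcard subsetUr.
by rewrite u1 -u2.
Qed.

(** * Quadratic forms on the coefficients, split by order and labeled edges *)

Local Open Scope ring_scope.

Definition pker N (d : nat) (f : nat -> R) (p q : profile N) : R :=
  if pedges (pjoin p q) == d then f (pdegsq (pjoin p q)) else 0.

Definition fully_labeled N (S : {set 'I_N * 'I_N}) : profile N :=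
  Profile S 0 [ffun=> 0%N] 0.

Lemma sum_sum_sq (I : finType) (P : pred I) (c a : I -> R) :
  \sum_(i | P i) \sum_(j | P j) c i * c j * (a i * a j) =
  (\sum_(i | P i) c i * a i) ^+ 2.
Proof.
rewrite expr2 mulr_suml; apply: eq_bigr => i _; rewrite mulr_sumr.
by apply: eq_bigr => j _; ring.
Qed.

Lemma valid_wgt0 N (p : profile N) : valid p -> wgt p = 0%N ->
  p = fully_labeled (lset p).
Proof. by case: p => S U a b [_ _ _ /= h _] u0; have [-> ->] := h u0; rewrite u0. Qed.

Section Gram.
Variables (N : nat) (I : finType) (c : I -> R) (k : I -> profile N).
Hypothesis vk : forall i, valid (k i).

Definition gram d f := \sum_i \sum_j c i * c j * pker d f (k i) (k j).

(* The terms of order below [d] cancel, profile by profile. *)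
Definition null d := forall psi : profile N -> R,
  \sum_(i | (pord (k i) < d)%N) c i * psi (k i) = 0.

Definition level d S i := (pord (k i) == d) && (lset (k i) == S).

Definition level_gram d f S := \sum_(i | level d S i) \sum_(j | level d S j)
    c i * c j * f (pdegsq (pjoin (k i) (k j))).

(** Nullity removes the terms of order below [d] in each variable. Among the others, [pedges_pjoin]
    leaves only pairs of order exactly [d] with the same labeled edges, so the form is block
    diagonal. *)
Lemma gram_null d f : null d -> gram d f = \sum_S level_gram d f S.
Proof.
move=> nd; pose high i := (d <= pord (k i))%N.
have cut psi : \sum_i c i * psi (k i) = \sum_(i | high i) c i * psi (k i).
  rewrite (bigID (fun i => pord (k i) < d)%N) /= nd add0r.
  by apply: eq_bigl => i; rewrite -leqNgt.
have -> : gram d f = \sum_(i | high i) \sum_(j | high j)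
    c i * c j * pker d f (k i) (k j).
  rewrite /gram; under eq_bigr => i _.
    under eq_bigr => j _ do rewrite -mulrA.
    rewrite -mulr_sumr (cut (pker d f (k i))); over.
  rewrite (cut (fun p => \sum_(j | high j) c j * pker d f p (k j))).
  apply: eq_bigr => i _; rewrite mulr_sumr.
  by apply: eq_bigr => j _; rewrite mulrA.
rewrite (bigID (fun i => pord (k i) == d)) /= [X in _ + X]big1 ?addr0; last first.
  move=> i /andP [hi /negbTE ni]; apply: big1 => j hj.
  by rewrite /pker (pedges_pjoin hi hj) ni /= andbF mulr0.
rewrite (partition_big (fun i => lset (k i)) xpredT) //=.
apply: eq_bigr => S _; apply: eq_big => [i|i].
  by rewrite /high /level; case: eqP => //= [->|]; rewrite ?leqnn ?andbF ?andbT.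
move=> /andP [/andP [hi /eqP di] /eqP Si].
rewrite (bigID (level d S)) /= [X in _ + X]big1 ?addr0; last first.
  move=> j /andP [hj nj]; rewrite /pker (pedges_pjoin hi hj) Si di eqxx /=.
  by move: nj; rewrite /level andbC [lset _ == _]eq_sym => /negbTE ->; rewrite mulr0.
apply: eq_big => [j|j /andP [hj /andP [/eqP dj /eqP Sj]]].
  by rewrite /high /level; case: eqP => /= [->|]; rewrite ?leqnn ?andbF.
by rewrite /pker (pedges_pjoin hi hj) Si Sj di dj !eqxx.
Qed.

Lemma null0 : null 0.
Proof. by move=> psi; rewrite big_pred0. Qed.

(** By parity, an order below [d + 2] is either below [d] or equal to [d]. *)
Lemma null_step d : ~~ odd d -> null d ->
  (forall S psi, \sum_(i | level d S i) c i * psi (k i) = 0) -> null d.+2.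
Proof.
move=> ed nd nS psi; rewrite (bigID (fun i => pord (k i) < d)%N) /=.
rewrite [X in X + _](eq_bigl (fun i => pord (k i) < d)%N) ?nd ?add0r; last first.
  by move=> i; move: (pord (k i)) => a; lia.
rewrite (eq_bigl (fun i => pord (k i) == d)); last first.
  by move=> i; have := pord_even (vk i); move: (pord (k i)) => a ha; lia.
rewrite (partition_big (fun i => lset (k i)) xpredT) //=.
by rewrite big1 // => S _; exact: nS.
Qed.

(** All profiles in the block equal [fully_labeled S], so the kernel is constant there. *)
Lemma level_gram_full d f S : (forall i, level d S i -> wgt (k i) = 0%N) ->
  level_gram d f S = f (\sum_l ldeg S l ^ 2)%N * (\sum_(i | level d S i) c i) ^+ 2.
Proof.
move=> w0; have kE i : level d S i -> k i = fully_labeled S.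
  by move=> hi; rewrite (valid_wgt0 (vk i) (w0 i hi)); case/andP: hi => _ /eqP ->.
have -> : \sum_(i | level d S i) c i = \sum_(i | level d S i) c i * 1.
  by apply: eq_bigr => i _; rewrite mulr1.
rewrite -sum_sum_sq mulr_sumr; apply: eq_bigr => i hi; rewrite mulr_sumr.
apply: eq_bigr => j hj; rewrite (kE i hi) (kE j hj) /pdegsq /= setUid !addn0.
rewrite mulr1 mulr1 [RHS]mulrC; congr (_ * f _).
by apply: eq_bigr => l _; rewrite !ffunE !addn0.
Qed.

Lemma level_full_null d S : (forall i, level d S i -> wgt (k i) = 0%N) ->
  \sum_(i | level d S i) c i = 0 ->
  forall psi, \sum_(i | level d S i) c i * psi (k i) = 0.
Proof.
move=> w0 s0 psi.
transitivity ((\sum_(i | level d S i) c i) * psi (fully_labeled S)); last first.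
  by rewrite s0 mul0r.
rewrite mulr_suml.
apply: eq_bigr => i hi; rewrite (valid_wgt0 (vk i) (w0 i hi)).
by case/andP: hi => _ /eqP ->.
Qed.

Lemma level_wgt d S i : level d S i ->
  [/\ (#|S| + (wgt (k i)).*2 = d)%N, ~~ odd #|S| & ~~ odd (wgt (k i))].
Proof.
move=> /andP [/eqP h /eqP e]; split; last exact: val_wgt.
  by rewrite -e -h.
by rewrite -e lset_even.
Qed.

(* The sum of the squared degrees is 4 on two disjoint edges and 6 on the path
   with two edges; it is 6 on three disjoint edges, 8 on an edge and a path with
   two edges, 10 on the path with three edges, 12 on the star and the triangle.
   The values of [pf6] are chosen such that, for two graphs consisting of the
   labeled edge [ab] and one more edge, the product gets the value
   [1 + (x - y) (x' - y')], where [x] and [y] tell whether the extra edge is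
   attached to [a] or [b]. *)
Definition pf1 (_ : nat) : R := 1.
Definition pf4 (D : nat) : R := D%:R / 2 - 1.
Definition pf6 (D : nat) : R := if D == 10%N then 0 else if D == 12%N then 2 else 1.

Lemma level_wgt_small d S i : (d <= 2)%N -> level d S i -> wgt (k i) = 0%N.
Proof.
by move=> d2 /level_wgt []; move: #|S| (wgt (k i)) => a u; lia.
Qed.

(** Every block is the square of its coefficient sum. If that sum vanishes, the block cancels, since
    it contains a single profile. *)
Lemma gram_small d : (d <= 2)%N -> ~~ odd d -> null d ->
  0 <= gram d pf1 /\ (gram d pf1 = 0 -> null d.+2).
Proof.
move=> d2 ed nd; rewrite gram_null //.
have lg S : level_gram d pf1 S = (\sum_(i | level d S i) c i) ^+ 2.
  by rewrite level_gram_full ?mul1r // => i; apply: level_wgt_small.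
have ge0 S : true -> 0 <= level_gram d pf1 S by rewrite lg sqr_ge0.
split; first exact: sumr_ge0.
move=> /(psumr_eq0P ge0) z; apply: null_step => // S.
apply: level_full_null => [i|]; first exact: level_wgt_small.
by apply/eqP; rewrite -sqrf_eq0 -lg z.
Qed.

End Gram.

(** * The forms on products with two and three edges *)

Lemma ffun_sum_le1 (J : finType) (a : {ffun J -> nat}) : (\sum_l a l <= 1)%N ->
  a = [ffun=> 0%N] \/ exists l0, a = [ffun l => (l == l0) : nat].
Proof.
move=> h; case: (pickP (fun l => a l != 0%N)) => [l0 hl|h0]; last first.
  by left; apply/ffunP => l; rewrite ffunE; have /eqP := h0 l.
right; exists l0; apply/ffunP => l; rewrite ffunE.
have [->|ne] := eqVneq l l0; first by move: h; rewrite (bigD1 l0) //=; lia.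
by move: h; rewrite (bigD1 l0) //= (bigD1 l) //=; lia.
Qed.

Lemma pdegsq_pjoin2 N (S : {set 'I_N * 'I_N}) (p q : profile N) :
  valid p -> valid q -> wgt p = 2%N -> wgt q = 2%N -> lset p = S -> lset q = S ->
  pdegsq (pjoin p q) = (\sum_l ldeg S l ^ 2 +
    2 * \sum_l ldeg S l * (pend p l + pend q l) +
    2 * \sum_l pend p l * pend q l + 4)%N.
Proof.
move=> vp vq wp wq Sp Sq.
rewrite /pdegsq /= Sp Sq setUid.
have -> : (\sum_l (ldeg S l + [ffun l0 => pend p l0 + pend q l0] l) ^ 2 =
  \sum_l ldeg S l ^ 2 + 2 * \sum_l ldeg S l * (pend p l + pend q l) +
  2 * \sum_l pend p l * pend q l + (\sum_l pend p l ^ 2 + \sum_l pend q l ^ 2))%N.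
  rewrite !big_distrr /= -!big_split /=; apply: eq_bigr => l _; rewrite ffunE.
  by move: (ldeg S l) (pend p l) (pend q l) => x y z; nia.
(* Each extra edge contributes 2 through its own squared degrees, whether attached or free; hence
   the constant 4. *)
have [_ eq] := val_wgt2 vq wq; have [_ ep] := val_wgt2 vp wp.
rewrite -addnA; congr (_ + _)%N.
transitivity ((usq p + \sum_l pend p l ^ 2) + (usq q + \sum_l pend q l ^ 2))%N.
  by rewrite addnC addnACA.
by rewrite ep eq.
Qed.

Lemma ldeg_edge N (S : {set 'I_N * 'I_N}) :
  (forall i j, ((i, j) \in S) = ((j, i) \in S)) -> (forall i, (i, i) \notin S) ->
  #|S| = 2%N ->
  exists a b, a != b /\ forall l, ldeg S l = ((l == a) + (l == b))%N.
Proof.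
move=> Ss Si S2; have /card_gt0P [[a b] hab] : (0 < #|S|)%N by rewrite S2.
have nab : a != b by apply/eqP => e; rewrite e (negbTE (Si b)) in hab.
exists a, b; split => // l.
have SE : S = [set (a, b); (b, a)].
  apply/esym/eqP; rewrite eqEcard S2 cards2 xpair_eqE (negbTE nab) /= andbT.
  by apply/subsetP => x /set2P [] ->; rewrite // Ss.
rewrite /ldeg SE; under eq_bigr => m _ do rewrite !inE !xpair_eqE.
have [->|la] := eqVneq l a.
  rewrite (negbTE nab) (bigD1 b) //= eqxx big1 //.
  by move=> m /negbTE ->.
have [_|lb] := eqVneq l b.
  rewrite (bigD1 a) //= eqxx big1 // => m /negbTE ->.
  by [].
by rewrite big1.
Qed.

Lemma pf6_pjoin N (S : {set 'I_N * 'I_N}) (p q : profile N) a b :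
  valid p -> valid q -> wgt p = 2%N -> wgt q = 2%N -> lset p = S -> lset q = S ->
  a != b -> (forall l, ldeg S l = ((l == a) + (l == b))%N) ->
  pf6 (pdegsq (pjoin p q)) =
  1 * 1 + ((pend p a)%:R - (pend p b)%:R) * ((pend q a)%:R - (pend q b)%:R).
Proof.
move=> vp vq wp wq Sp Sq nab dS; rewrite (pdegsq_pjoin2 vp vq wp wq Sp Sq).
have sE (x : 'I_N -> nat) : (\sum_l ldeg S l * x l = x a + x b)%N.
  under eq_bigr => l _ do rewrite dS mulnDl.
  rewrite big_split /=; congr (_ + _)%N.
    by rewrite (bigD1 a) //= eqxx mul1n big1 ?addn0 // => l /negbTE ->.
  by rewrite (bigD1 b) //= eqxx mul1n big1 ?addn0 // => l /negbTE ->.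
rewrite sE; under eq_bigr => l _ do rewrite -mulnn.
rewrite sE !dS !eqxx (negbTE nab) eq_sym (negbTE nab).
have [hp _] := val_wgt2 vp wp; have [hq _] := val_wgt2 vq wq.
(* Each extra edge is free or attached to one label; the value depends on the position of these
   labels relative to [a], [b] and each other. *)
have [pE|[i pE]] := ffun_sum_le1 hp; have [qE|[j qE]] := ffun_sum_le1 hq; rewrite pE qE.
- rewrite big1 ?ffunE; first by rewrite /pf6 /=; ring.
  by move=> l _; rewrite ffunE.
- rewrite big1; last by move=> l _; rewrite ffunE.
  rewrite !ffunE subrr mul0r mulr1 addr0.
  have [<-|na] := eqVneq a j; first by rewrite eq_sym (negbTE nab).
  by case: eqP.
- rewrite big1; last by move=> l _; rewrite !ffunE muln0.
  rewrite !ffunE subrr mulr0 mulr1 addr0.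
  have [<-|na] := eqVneq a i; first by rewrite eq_sym (negbTE nab).
  by case: eqP.
have -> : (\sum_l [ffun l0 => (l0 == i) : nat] l * [ffun l0 => (l0 == j) : nat] l = (i == j))%N.
  rewrite (bigD1 i) //= !ffunE eqxx mul1n big1 ?addn0 //.
  by move=> l /negbTE nl; rewrite !ffunE nl.
rewrite !ffunE.
have [ai|ai] := eqVneq a i; have [aj|aj] := eqVneq a j;
have [bi|bi] := eqVneq b i; have [bj|bj] := eqVneq b j; subst; rewrite ?eqxx // in nab *;
rewrite ?(negbTE ai) ?(negbTE aj) ?(negbTE bi) ?(negbTE bj) /pf6 /=;
try ring.
- by rewrite [i == j]eq_sym (negbTE ai) /=; ring.
- by rewrite [i == j]eq_sym (negbTE bi) /=; ring.
- by case: (i == j) => /=; ring.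
Qed.

Section GramHigh.
Variables (N : nat) (I : finType) (c : I -> R) (k : I -> profile N).
Hypothesis vk : forall i, valid (k i).

(** If [S] consisted of one edge, the weight would be 1, which is odd. *)
Lemma level4_wgt S i : level k 4 S i -> S != set0 -> wgt (k i) = 0%N.
Proof.
move=> /(level_wgt vk) []; rewrite -card_gt0.
by move: #|S| (wgt (k i)) => a u; lia.
Qed.

Lemma level4_set0_wgt i : level k 4 set0 i -> wgt (k i) = 2%N.
Proof. by move=> /(level_wgt vk) []; rewrite cards0; lia. Qed.

(** Without labeled edges, [pdegsq_pjoin2] gives 4 plus twice the inner product of the two [pend]
    vectors, which [pf4] turns into 1 plus that inner product. *)
Lemma level_gram4_set0 : level_gram c k 4 pf4 set0 =
  (\sum_(i | level k 4 set0 i) c i) ^+ 2 +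
  \sum_l (\sum_(i | level k 4 set0 i) c i * (pend (k i) l)%:R) ^+ 2.
Proof.
have -> : \sum_(i | level k 4 set0 i) c i = \sum_(i | level k 4 set0 i) c i * 1.
  by apply: eq_bigr => i _; rewrite mulr1.
under [X in _ + X]eq_bigr => l _ do rewrite -sum_sum_sq.
rewrite -sum_sum_sq [X in _ = _ + X]exchange_big -big_split /=; apply: eq_bigr => i hi.
rewrite [X in _ = _ + X]exchange_big -big_split /=; apply: eq_bigr => j hj.
have [/andP [_ /eqP si] /andP [_ /eqP sj]] := (hi, hj).
rewrite (pdegsq_pjoin2 (vk i) (vk j) (level4_set0_wgt hi) (level4_set0_wgt hj) si sj).
have d0 l : ldeg (set0 : {set 'I_N * 'I_N}) l = 0%N.
  by rewrite /ldeg big1 // => m _; rewrite inE.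
rewrite big1 => [|l _]; last by rewrite d0.
rewrite big1 => [|l _]; last by rewrite d0.
rewrite -mulr_sumr -mulrDr; congr (_ * _).
have -> : \sum_l (pend (k i) l)%:R * (pend (k j) l)%:R =
    (\sum_l pend (k i) l * pend (k j) l)%N%:R :> R.
  by rewrite natr_sum; apply: eq_bigr => l _; rewrite natrM.
rewrite /pf4 muln0 !add0n natrD natrM; lra.
Qed.

Lemma pf4_full_gt0 (S : {set 'I_N * 'I_N}) : (4 <= #|S|)%N ->
  0 < pf4 (\sum_l ldeg S l ^ 2).
Proof.
move=> h; have h4 : (4 <= \sum_l ldeg S l ^ 2)%N.
  apply: (leq_trans h); rewrite -sum_ldeg; apply: leq_sum => l _.
  by case: (ldeg S l) => // n; rewrite -mulnn leq_pmulr.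
have : (4%:R <= (\sum_l ldeg S l ^ 2)%N%:R :> R) by rewrite ler_nat.
rewrite /pf4; lra.
Qed.

Lemma level_gram4_ge0 S : 0 <= level_gram c k 4 pf4 S.
Proof.
have [->|S0] := eqVneq S set0.
  rewrite level_gram4_set0; apply: addr_ge0; first exact: sqr_ge0.
  by apply: sumr_ge0 => l _; apply: sqr_ge0.
rewrite (level_gram_full _ vk) => [|i /level4_wgt]; last exact.
case: (pickP (level k 4 S)) => [i hi|h0]; last first.
  by rewrite (eq_bigl _ _ h0) big_pred0_eq expr0n /= mulr0.
apply: mulr_ge0; last exact: sqr_ge0.
apply/ltW/pf4_full_gt0; have [] := level_wgt vk hi.
by rewrite (level4_wgt hi S0) addn0 => ->.
Qed.

(** For empty [S], a profile is determined by the label to which its edge is attached, if any. So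
    [psi] is affine in [pend], and the vanishing squares cancel its constant and linear parts. *)
Lemma level4_null S psi : level_gram c k 4 pf4 S = 0 ->
  \sum_(i | level k 4 S i) c i * psi (k i) = 0.
Proof.
have [->|S0] := eqVneq S set0; last first.
  have w0 i : level k 4 S i -> wgt (k i) = 0%N by move/level4_wgt; apply.
  rewrite (level_gram_full _ vk) // => /eqP.
  case: (pickP (level k 4 S)) => [i hi|h0 _]; last by rewrite big_pred0.
  rewrite mulf_eq0 gt_eqF /=; last first.
    apply/pf4_full_gt0; have [] := level_wgt vk hi.
    by rewrite (w0 _ hi) addn0 => ->.
  by rewrite sqrf_eq0 => /eqP s0; apply: level_full_null.
rewrite level_gram4_set0 => /eqP; rewrite paddr_eq0 ?sqr_ge0 //; last first.
  by apply: sumr_ge0 => l _; apply: sqr_ge0.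
move=> /andP []; rewrite sqrf_eq0 => /eqP c0 /eqP.
have ge0 l : true -> 0 <= (\sum_(i | level k 4 set0 i) c i * (pend (k i) l)%:R) ^+ 2.
  by move=> _; apply: sqr_ge0.
move=> /(psumr_eq0P ge0) cl {ge0}.
(* The values of [psi] at a free edge and at an edge attached to [l0]. *)
pose psi0 := psi (Profile set0 2 [ffun=> 0%N] 2).
pose psi1 l0 := psi (Profile set0 2 [ffun l => (l == l0) : nat] 1).
have psiE i : level k 4 set0 i -> psi (k i) =
    psi0 + \sum_l (pend (k i) l)%:R * (psi1 l - psi0).
  move=> hi; have w2 := level4_set0_wgt hi; have [p1 us] := val_wgt2 (vk i) w2.
  have /andP [_ /eqP si] := hi.
  case: (k i) w2 p1 us si => S1 U a b /= -> a1 us ->.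
  have [aE|[l0 aE]] := ffun_sum_le1 a1; subst a.
    rewrite big1 ?addr0; last by move=> l _; rewrite ffunE mul0r.
    by move: us; rewrite big1 ?addn0 => [->//|l _]; rewrite ffunE.
  rewrite (bigD1 l0) //= ffunE eqxx mul1r big1 => [|l /negbTE nl]; last first.
    by rewrite ffunE nl mul0r.
  rewrite addr0 addrC subrK /psi1; congr (psi (Profile _ _ _ _)).
  move: us; rewrite (bigD1 l0) //= ffunE eqxx big1 => [|l /negbTE nl]; last first.
    by rewrite ffunE nl.
  by lia.
under eq_bigr => i hi do rewrite (psiE i hi) mulrDr mulr_sumr.
rewrite big_split /= -mulr_suml c0 mul0r add0r exchange_big big1 // => l _.
under eq_bigr => i _ do rewrite mulrA.
rewrite -mulr_suml; have /eqP := cl l isT; rewrite sqrf_eq0 => /eqP ->.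
by rewrite mul0r.
Qed.

Lemma gram4 : null c k 4 -> 0 <= gram c k 4 pf4 /\ (gram c k 4 pf4 = 0 -> null c k 6).
Proof.
move=> n4; rewrite gram_null //.
split; first by apply: sumr_ge0 => S _; apply: level_gram4_ge0.
move=> /psumr_eq0P z; apply: null_step => // S psi; apply: level4_null.
by apply: z => // T _; apply: level_gram4_ge0.
Qed.

Lemma pf6_ge0 D : 0 <= pf6 D.
Proof. by rewrite /pf6; case: ifP => // _; case: ifP. Qed.

(** Since [#|S|] and the weight are even and [#|S|] plus twice the weight is 6, they are 6 and 0, or
    2 and 2. The first case is a multiple of a square; in the second, [pf6_pjoin] gives a sum of two
    squares. *)
Lemma gram6 : null c k 6 -> 0 <= gram c k 6 pf6.
Proof.
move=> n6; rewrite gram_null //; apply: sumr_ge0 => S _.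
have [S2|S2] := eqVneq #|S| 2%N; last first.
  rewrite (level_gram_full _ vk) => [|i /(level_wgt vk) []].
    by apply: mulr_ge0; [apply: pf6_ge0|apply: sqr_ge0].
  by move: #|S| S2 (wgt (k i)) => a /eqP h u; lia.
case: (pickP (level k 6 S)) => [i0 hi0|h0]; last by rewrite /level_gram big_pred0.
have [a [b [nab dS]]] : exists a b, a != b /\ forall l, ldeg S l = ((l == a) + (l == b))%N.
  have /andP [_ /eqP Si] := hi0; rewrite -Si.
  by apply: ldeg_edge; [exact: val_sym|exact: val_irr|rewrite Si].
have w2 i : level k 6 S i -> wgt (k i) = 2%N.
  by move=> /(level_wgt vk) []; rewrite S2; lia.
have -> : level_gram c k 6 pf6 S = (\sum_(i | level k 6 S i) c i * 1) ^+ 2 +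
   (\sum_(i | level k 6 S i) c i * ((pend (k i) a)%:R - (pend (k i) b)%:R)) ^+ 2.
  rewrite -!sum_sum_sq -big_split; apply: eq_bigr => i hi.
  rewrite -big_split; apply: eq_bigr => j hj /=; rewrite -mulrDr; congr (_ * _).
  have [/andP [_ /eqP si] /andP [_ /eqP sj]] := (hi, hj).
  exact: (pf6_pjoin (vk i) (vk j) (w2 i hi) (w2 j hj) si sj nab dS).
by apply: addr_ge0; apply: sqr_ge0.
Qed.

End GramHigh.

(** * Linear functionals and their compatibility with the quotient *)

Definition linext (lam : plg -> R) (f : comb) : R := \sum_(p <- f) p.1 * lam p.2.

(** Induction on the length, discarding the whole isomorphism class of the first graph at once: its
    coefficients sum to 0. *)
Lemma coef0_linext0 (lam : plg -> R) (h : comb) :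
  (forall H H', iso H H' -> lam H = lam H') ->
  (forall H, coef h H = 0) -> linext lam h = 0.
Proof.
move=> lam_iso; have [n] := ubnP (size h); elim: n h => // n IH [|p h] hs h0.
  by rewrite /linext big_nil.
rewrite /linext (bigID (fun q : R * plg => iso q.2 p.2)) /=.
rewrite (eq_bigr (fun q : R * plg => q.1 * lam p.2)) => [|q /lam_iso -> //].
rewrite -mulr_suml -/(coef (p :: h) p.2) h0 mul0r add0r -big_filter /= iso_refl /=.
apply: IH => [|H].
  by move: hs; rewrite /= ltnS; apply: leq_ltn_trans; rewrite size_filter count_size.
rewrite /coef big_filter_cond; have [Hp|nHp] := boolP (iso H p.2).
  rewrite big_pred0 // => q; apply/negbTE/negP => /andP [/negP nq qH].
  by apply: nq; apply: iso_trans Hp.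
rewrite -[RHS](h0 H) /coef big_cons ifN; last by apply: contraNN nHp => /iso_sym.
apply: eq_bigl => q; case qH: (iso q.2 H); rewrite ?andbF // andbT.
by apply: contraNN nHp => qp; apply: iso_trans qp; apply: iso_sym.
Qed.

Lemma linext_cat lam f g : linext lam (f ++ g) = linext lam f + linext lam g.
Proof. by rewrite /linext big_cat. Qed.

Lemma linext_csub lam f g : linext lam (csub f g) = linext lam f - linext lam g.
Proof.
rewrite /csub /cadd linext_cat; congr (_ + _).
rewrite /linext big_map -sumrN; apply: eq_bigr => p _ /=; ring.
Qed.

Lemma coef_csub f g H : coef (csub f g) H = coef f H - coef g H.
Proof.
rewrite /csub /cadd /coef big_cat; congr (_ + _).
by rewrite big_map -sumrN; apply: eq_bigr => p _ /=; ring.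
Qed.

Lemma eqF_linext (lam : plg -> R) (f g : comb) :
  (forall H H', iso H H' -> lam H = lam H') -> eqF f g -> linext lam f = linext lam g.
Proof.
move=> lam_iso fg; apply/eqP; rewrite -subr_eq0 -linext_csub; apply/eqP.
by apply: coef0_linext0 => // H; rewrite coef_csub fg subrr.
Qed.

Lemma linext_cmul lam f g : linext lam (cmul f g) =
  \sum_(p <- f) \sum_(q <- g) p.1 * q.1 * lam (gprod p.2 q.2).
Proof. by rewrite /linext big_allpairs_dep. Qed.

Lemma linext_csum lam fs : linext lam (csum fs) = \sum_(f <- fs) linext lam f.
Proof. by rewrite /linext big_flatten. Qed.

Lemma sum_In0 (T : Type) (s : seq T) (F : T -> R) :
  (forall x, List.In x s -> F x = 0) -> \sum_(x <- s) F x = 0.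
Proof.
elim: s => [|x s IH] h; rewrite ?big_nil // big_cons h /=; last by left.
by rewrite IH ?addr0 // => y ys; apply: h; right.
Qed.

Lemma sum_In_ge0 (T : Type) (s : seq T) (F : T -> R) :
  (forall x, List.In x s -> 0 <= F x) -> 0 <= \sum_(x <- s) F x.
Proof.
elim: s => [|x s IH] h; rewrite ?big_nil // big_cons; apply: addr_ge0.
  by apply: h; left.
by apply: IH => y ys; apply: h; right.
Qed.

Lemma sum_In_eq0 (T : Type) (s : seq T) (F : T -> R) :
  (forall x, List.In x s -> 0 <= F x) -> \sum_(x <- s) F x = 0 ->
  forall x, List.In x s -> F x = 0.
Proof.
elim: s => [|x s IH] h //; rewrite big_cons => /eqP.
have h' y : List.In y s -> 0 <= F y by move=> ys; apply: h; right.
rewrite paddr_eq0; [|by apply: h; left|exact: sum_In_ge0].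
move=> /andP [/eqP x0 /eqP s0] y [<- //|]; exact: IH.
Qed.

Lemma In_nth (T : Type) (x0 : T) s i : (i < size s)%N -> List.In (nth x0 s i) s.
Proof. by elim: s i => // x s IH [_|i hi]; [left|right; apply: IH]. Qed.

Lemma ex_labs_lt (g : comb) : exists N, forall p, List.In p g -> labs_lt N p.2.
Proof.
elim: g => [|p g [N IH]]; first by exists 0%N.
exists (maxn N (\sum_(l <- labs p.2) l).+1) => q [<-|/IH /allP qN]; apply/allP => l lq.
  rewrite leq_max; apply/orP; right; rewrite ltnS (big_rem l) //=; exact: leq_addr.
by rewrite leq_max qN.
Qed.

Lemma labs_lt_gprod N F1 F2 : labs_lt N F1 -> labs_lt N F2 -> labs_lt N (gprod F1 F2).
Proof.
move=> /allP h1 /allP h2; apply/allP => l; rewrite mem_undup mem_cat.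
by case/orP => [/h1|/h2].
Qed.

Definition stat (d : nat) (f : nat -> R) (H : plg) : R :=
  if edges2 H == d then f (degsq H) else 0.

Lemma stat_iso d f H H' : iso H H' -> stat d f H = stat d f H'.
Proof. by move=> /iso_stats [e1 e2]; rewrite /stat e1 e2. Qed.

Lemma stat_unl d f H : stat d f (unl H) = stat d f H.
Proof. by have [e1 e2] := unl_stats H; rewrite /stat e1 e2. Qed.

Lemma linext_cunl d f g : linext (stat d f) (cunl g) = linext (stat d f) g.
Proof. by rewrite /linext big_map; apply: eq_bigr => p _ /=; rewrite stat_unl. Qed.

Lemma stat_gprod N d f F1 F2 : labs_lt N F1 -> labs_lt N F2 ->
  stat d f (gprod F1 F2) = pker d f (profile_of N F1) (profile_of N F2).
Proof.
move=> h1 h2; have [e1 e2] := @profile_stats N (gprod F1 F2) (undup_uniq _) (labs_lt_gprod h1 h2).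
by rewrite /stat e1 e2 profile_gprod.
Qed.

Lemma profile_edgeless N H : (forall u v, cedge H u v = false) ->
  profile_of N H = fully_labeled set0.
Proof.
move=> h; have p0 u : pendants H u = 0%N by rewrite /pendants big1 // => k _; rewrite h.
have u0 k : udeg N H k = 0%N by rewrite /udeg p0 addn0 big1 // => l _; rewrite h.
rewrite /profile_of; congr Profile.
- by apply/setP => ij; rewrite !inE h.
- by rewrite !big1 // => *; rewrite ?p0 ?u0.
- by apply/ffunP => l; rewrite !ffunE p0.
- by rewrite big1 // => k _; rewrite u0.
Qed.

Lemma one_vertex_edgeless H u v : wf H -> one_vertex H -> cedge H u v = false.
Proof.
move=> wH; rewrite /one_vertex => H1.
case hu: (in_vtx H u); last by rewrite /cedge hu.
case hv: (in_vtx H v); last by rewrite /cedge hv andbF.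
have [x <-] := emb_surj hu; have [y <-] := emb_surj hv.
have /fintype_le1P h1 : (#|vtx H| <= 1)%N by rewrite card_sum !card_ord (eqP H1).
rewrite (h1 x y); exact: cedge_irr.
Qed.

(** A one-vertex graph has the same profile as the empty graph, so multiplying by either gives the
    same statistics. *)
Lemma inK_stat d f g : inK g -> linext (stat d f) g = 0.
Proof.
move=> [hs [hsP /(eqF_linext (@stat_iso d f)) ->]].
rewrite linext_csum big_map; apply: sum_In0 => h /hsP [wh [wF F1]].
rewrite linext_cmul; apply: sum_In0 => p ph.
rewrite !big_cons big_nil /= addr0 mulr1.
(* The list provides a common bound for the labels of both factors. *)
have [N hN] := ex_labs_lt [:: p; (1, h.2)].
have hp : labs_lt N p.2 by apply: hN; left.
have hF : labs_lt N h.2 by apply: (hN (1, h.2)); right; left.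
rewrite (stat_gprod _ _ hp hF) (@stat_gprod N _ _ _ empty_plg hp isT).
rewrite (@profile_edgeless N h.2) => [|u v]; last exact: one_vertex_edgeless.
rewrite (@profile_edgeless N empty_plg) => [|[l|l] v //].
by rewrite mulrN1 mulNr subrr.
Qed.

Lemma eqA_stat d f g h : eqA g h -> linext (stat d f) g = linext (stat d f) h.
Proof. by move=> /(inK_stat d f) /eqP; rewrite linext_csub subr_eq0 => /eqP. Qed.

Lemma linext_square N d f (g : comb) : (forall p, List.In p g -> labs_lt N p.2) ->
  linext (stat d f) (cmul g g) =
  gram (fun i : 'I_(size g) => (nth (0, empty_plg) g i).1)
       (fun i => profile_of N (nth (0, empty_plg) g i).2) d f.
Proof.
move=> gN; rewrite linext_cmul (big_nth (0, empty_plg)) big_mkord.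
apply: eq_bigr => i _; rewrite (big_nth (0, empty_plg)) big_mkord.
by apply: eq_bigr => j _; rewrite (@stat_gprod N) //; apply/gN/In_nth.
Qed.

(** Each vanishing value cancels one more order of terms of [g], which makes the next form
    nonnegative. The indices 0, 2, 4, 6 stand for 0 to 3 edges. *)
Lemma square_stat_ge0 (g : comb) : wfc g ->
  let q d f := linext (stat d f) (cmul g g) in
  [/\ 0 <= q 0%N pf1, q 0%N pf1 = 0 -> 0 <= q 2%N pf1,
      q 0%N pf1 = 0 -> q 2%N pf1 = 0 -> 0 <= q 4%N pf4 &
      q 0%N pf1 = 0 -> q 2%N pf1 = 0 -> q 4%N pf4 = 0 -> 0 <= q 6%N pf6].
Proof.
move=> wg q; have [N gN] := ex_labs_lt g; rewrite /q !(linext_square _ _ gN).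
set c := fun _ => _; set k := fun _ => profile_of _ _.
have vk i : valid (k i) by apply: valid_profile; apply/wg/In_nth.
have [p0 n2] := gram_small vk (isT : 0 <= 2)%N isT (@null0 _ _ c k).
split=> [//|/n2|/n2|/n2]; first by move=> h; have [] := gram_small vk (isT : 2 <= 2)%N isT h.
  move=> h; have [_ n4] := gram_small vk (isT : 2 <= 2)%N isT h => /n4 h4.
  by have [] := gram4 vk h4.
move=> h; have [_ n4] := gram_small vk (isT : 2 <= 2)%N isT h => /n4 h4.
by have [_ n6] := gram4 vk h4 => /n6; apply: gram6.
Qed.

(** A vanishing sum of nonnegative values has only zero terms; applied at 0, 1 and 2 edges in turn,
    this gives every single square the hypotheses of [square_stat_ge0]. *)
Lemma sos_stat_ge0 (x : comb) : is_sos x ->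
  linext (stat 0 pf1) x = 0 -> linext (stat 2 pf1) x = 0 ->
  linext (stat 4 pf4) x = 0 -> 0 <= linext (stat 6 pf6) x.
Proof.
move=> [gs [wgs xE]].
have E d f : linext (stat d f) x = \sum_(g <- gs) linext (stat d f) (cmul g g).
  by rewrite (eqA_stat d f xE) linext_cunl linext_csum big_map.
rewrite !E => z0 z2 z4.
have P g (gs_g : List.In g gs) := square_stat_ge0 (wgs g gs_g).
have q0 : forall g, List.In g gs -> linext (stat 0 pf1) (cmul g g) = 0.
  by apply: (sum_In_eq0 _ z0) => g /P [].
have q2 : forall g, List.In g gs -> linext (stat 2 pf1) (cmul g g) = 0.
  by apply: (sum_In_eq0 _ z2) => g hg; have [_ h _ _] := P g hg; apply/h/q0.
have q4 : forall g, List.In g gs -> linext (stat 4 pf4) (cmul g g) = 0.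
  by apply: (sum_In_eq0 _ z4) => g hg; have [_ _ h _] := P g hg; apply: h; auto.
by apply: sum_In_ge0 => g hg; have [_ _ _ h] := P g hg; apply: h; auto.
Qed.

(** * The witness and its failure to be a sum of squares *)

Definition adj_seq (es : seq (nat * nat)) (u v : nat + nat) : bool :=
  match u, v with inr i, inr j => ((i, j) \in es) || ((j, i) \in es) | _, _ => false end.

Definition path3 : plg := PLG [::] 4 (adj_seq [:: (0, 1); (1, 2); (2, 3)]%N).
Definition matching3 : plg := PLG [::] 6 (adj_seq [:: (0, 1); (2, 3); (4, 5)]%N).
Definition blakley_roy3 : comb := [:: (1, path3); (-1, matching3)].

Lemma path3_stats : edges2 path3 = 6%N /\ degsq path3 = 10%N.
Proof.
by rewrite /edges2 /degsq; do 2!rewrite !big_sumType !(big_ord_recl, big_ord0).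
Qed.

Lemma matching3_stats : edges2 matching3 = 6%N /\ degsq matching3 = 6%N.
Proof.
by rewrite /edges2 /degsq; do 2!rewrite !big_sumType !(big_ord_recl, big_ord0).
Qed.

Lemma blakley_roy3_not_sos : ~ is_sos blakley_roy3.
Proof.
have E d f : linext (stat d f) blakley_roy3 = if 6%N == d then f 10%N - f 6%N else 0.
  rewrite /linext !big_cons big_nil /= /stat.
  have [-> ->] := path3_stats; have [-> ->] := matching3_stats.
  by case: eqP => _; rewrite ?mulr0 ?addr0 // mul1r mulN1r.
(* Both graphs have three edges, so the lower functionals vanish; the last one takes the value
   [pf6 10 - pf6 6 = -1]. *)
move=> /sos_stat_ge0; rewrite !E /= /pf6 /= => /(_ erefl erefl erefl); lra.
Qed.

(** * Homomorphism densities as iterated sums *)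

Lemma sum_ffun_tuple (T : finType) n (F : {ffun 'I_n -> T} -> R) :
  \sum_psi F psi = \sum_(t : n.-tuple T) F [ffun i => tnth t i].
Proof.
apply: (reindex (fun t : n.-tuple T => [ffun i => tnth t i])).
apply: onW_bij; exists (fun psi : {ffun 'I_n -> T} => [tuple psi i | i < n]) => [t|psi].
  by apply: eq_from_tnth => i; rewrite tnth_mktuple ffunE.
by apply/ffunP => i; rewrite ffunE tnth_mktuple.
Qed.

Lemma sum_tuple_cons (T : finType) n (F : seq T -> R) :
  \sum_(t : n.+1.-tuple T) F t = \sum_a \sum_(t : n.-tuple T) F (a :: t).
Proof.
rewrite pair_bigA /= (reindex (fun p : T * n.-tuple T => [tuple of p.1 :: p.2])) //=.
apply: onW_bij; exists (fun t : n.+1.-tuple T => (thead t, [tuple of behead t])).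
  by move=> [a t] /=; congr pair; apply: val_inj.
by move=> t /=; rewrite [RHS]tuple_eta.
Qed.

(** For a concrete [n] this unfolds by computation into nested sums over [T]. *)
Fixpoint sum_seq (T : finType) n (F : seq T -> R) : R :=
  if n is m.+1 then \sum_a sum_seq m (fun s => F (a :: s)) else F [::].

Lemma sum_tupleE (T : finType) n (F : seq T -> R) :
  \sum_(t : n.-tuple T) F t = sum_seq n F.
Proof.
elim: n F => [|n IH] F /=; last first.
  by rewrite sum_tuple_cons; apply: eq_bigr => a _; exact: (IH (fun s => F (a :: s))).
by rewrite (big_pred1 [tuple]) // => t; apply/esym/eqP; apply: tuple0.
Qed.

(** On the right, [phi 0] is merely the default of [nth]: all endpoints are below [n]. *)
Lemma tH_adj_seq (T : finType) (e : rel T) (phi : nat -> T) n es :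
  symmetric e -> all (fun ij => (ij.1 < n) && (ij.2 < n))%N es ->
  let H := PLG [::] n (adj_seq es) in
  tH e phi H = (\sum_(t : n.-tuple T)
    (all (fun ij => e (nth (phi 0%N) t ij.1) (nth (phi 0%N) t ij.2)) es)%:R)
    / (#|T| ^ n)%:R.
Proof.
move=> es_sym /allP esn H; rewrite /tH -sum1_card natr_sum big_mkcond /=.
congr (_ / _); rewrite sum_ffun_tuple; apply: eq_bigr => t _.
set b := all _ _; rewrite inE /=; suff -> : [forall x : vtx H, forall y : vtx H, edge x y ==>
   e (@hom_map T phi H [ffun i => tnth t i] x) (@hom_map T phi H [ffun i => tnth t i] y)] = b.
  by case: b.
apply/forallP/allP => [h [i j] ij|h [[]//|i]].
  have /andP [/= hi hj] := esn _ ij.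
  have /forallP /(_ (inr (Ordinal hj))) := h (inr (Ordinal hi)).
  by rewrite /edge /= ij /= !ffunE !(tnth_nth (phi 0%N)).
apply/forallP => -[[]//|j]; apply/implyP; rewrite /edge /= !ffunE !(tnth_nth (phi 0%N)).
by case/orP => /h //=; rewrite es_sym.
Qed.

(** The three terms on the right have product [l ^+ 6], so their arithmetic mean is at least
    [l ^+ 2]. *)
Lemma amgm_edge (x y l : R) : 0 < x -> 0 < y -> 0 <= l ->
  3 * l ^+ 2 <= x * y + l ^+ 3 / x + l ^+ 3 / y.
Proof.
move=> x0 y0 l0; (* With [x = u^2] and [y = v^2] the difference is manifestly nonnegative. *)
have [u [u0 ->]] : exists u, 0 < u /\ x = u ^+ 2.
  by exists (Num.sqrt x); rewrite sqrtr_gt0 sqr_sqrtr ?ltW.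
have [v [v0 ->]] : exists v, 0 < v /\ y = v ^+ 2.
  by exists (Num.sqrt y); rewrite sqrtr_gt0 sqr_sqrtr ?ltW.
rewrite -subr_ge0.
have -> : u ^+ 2 * v ^+ 2 + l ^+ 3 / u ^+ 2 + l ^+ 3 / v ^+ 2 - 3 * l ^+ 2 =
  (l ^+ 3 * (u - v) ^+ 2 + u * v * ((u * v - l) ^+ 2 * (u * v + 2 * l))) / (u * v) ^+ 2.
  by field; rewrite !gt_eqF.
have uv0 : 0 < u * v by apply: mulr_gt0.
apply: divr_ge0; last exact: sqr_ge0.
apply: addr_ge0; first by apply: mulr_ge0; [apply: exprn_ge0|apply: sqr_ge0].
apply: mulr_ge0; first exact: ltW.
apply: mulr_ge0; [exact: sqr_ge0|lra].
Qed.

(** * Positivity of the witness *)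

Section Density.
Variables (T : finType) (e : rel T) (phi : nat -> T).
Hypotheses (e_sym : symmetric e).

Let A u v : R := (e u v)%:R.
Let deg u := \sum_v A u v.

Lemma tH_path3 : tH e phi path3 = (\sum_u \sum_v A u v * (deg u * deg v)) / (#|T| ^ 4)%:R.
Proof.
rewrite tH_adj_seq //; congr (_ / _).
rewrite (sum_tupleE _ (fun s =>
  (all (fun ij => e (nth (phi 0%N) s ij.1) (nth (phi 0%N) s ij.2)) _)%:R)) /=.
(* With the middle edge [b c] fixed, the sums over the two end vertices become degrees. *)
rewrite exchange_big /=; apply: eq_bigr => b _; rewrite exchange_big /=; apply: eq_bigr => c _.
rewrite mulrA mulr_sumr.
transitivity (\sum_a \sum_d A b c * A b a * A c d).
  apply: eq_bigr => a _; apply: eq_bigr => d _; rewrite /A (e_sym b a).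
  by case: (e a b) (e b c) (e c d) => [] [] []; rewrite /= ?(mul0r, mulr0, mul1r).
rewrite exchange_big; apply: eq_bigr => d _ /=.
by rewrite mulr_sumr mulr_suml.
Qed.

Lemma tH_matching3 : tH e phi matching3 = (\sum_u deg u) ^+ 3 / (#|T| ^ 6)%:R.
Proof.
rewrite tH_adj_seq //; congr (_ / _).
rewrite (sum_tupleE _ (fun s =>
  (all (fun ij => e (nth (phi 0%N) s ij.1) (nth (phi 0%N) s ij.2)) _)%:R)) /=.
have E : \sum_u \sum_v A u v = \sum_u deg u by [].
have S2 x : \sum_u \sum_v A u v * x = (\sum_u deg u) * x.
  by rewrite mulr_suml; apply: eq_bigr => u _; rewrite mulr_suml.
transitivity (\sum_a \sum_b A a b * (\sum_c \sum_d A c d * (\sum_u \sum_v A u v))).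
  apply: eq_bigr => a _; apply: eq_bigr => b _; rewrite mulr_sumr.
  apply: eq_bigr => c _; rewrite mulr_sumr; apply: eq_bigr => d _.
  rewrite !mulr_sumr; apply: eq_bigr => u _; rewrite !mulr_sumr; apply: eq_bigr => v _.
  rewrite /A.
  by case: (e a b) (e c d) (e u v) => [] [] []; rewrite /= ?(mul0r, mulr0, mul1r).
by rewrite !S2 E; ring.
Qed.

(** A vertex of positive degree contributes exactly 1, an isolated one 0. *)
Lemma sum_edge_inv_deg : \sum_u \sum_v A u v / deg u <= #|T|%:R.
Proof.
rewrite -sum1_card natr_sum; apply: ler_sum => u _; rewrite -mulr_suml -/(deg u).
have [->|d0] := eqVneq (deg u) 0; first by rewrite mul0r ler01.
by rewrite divff.
Qed.

(** Sum [amgm_edge] over all ordered edges, with [l = m / n] the average degree. The left side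
    becomes [3 * m ^+ 3 / n ^+ 2], and each of the two reciprocal sums is at most
    [l ^+ 3 * n = m ^+ 3 / n ^+ 2]. *)
Lemma path3_ge : (\sum_u deg u) ^+ 3 / #|T|%:R ^+ 2 <=
  \sum_u \sum_v A u v * (deg u * deg v).
Proof.
(* The existence of [phi] makes [T] nonempty. *)
have n0 : 0 < #|T|%:R :> R by rewrite ltr0n; apply/card_gt0P; exists (phi 0%N).
have A0 u v : 0 <= A u v by rewrite /A ler0n.
have d0 u : 0 <= deg u by apply: sumr_ge0.
set m := \sum_u deg u; set n := #|T|%:R; pose l := m / n.
have l0 : 0 <= l by apply: divr_ge0; [apply: sumr_ge0|apply: ltW].
have dpos u v : e u v -> 0 < deg u.
  move=> uv; rewrite /deg (bigD1 v) //= ltr_wpDr ?sumr_ge0 //.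
  by rewrite /A uv ltr01.
have key : \sum_u \sum_v A u v * (3 * l ^+ 2) <=
    \sum_u \sum_v A u v * (deg u * deg v) +
    (l ^+ 3 * \sum_u \sum_v A u v / deg u + l ^+ 3 * \sum_u \sum_v A u v / deg v).
  rewrite !mulr_sumr -!big_split; apply: ler_sum => u _ /=.
  rewrite !mulr_sumr -!big_split; apply: ler_sum => v _ /=.
  (* Pairs that are not edges give 0 on both sides; on an edge both degrees are positive. *)
  case uv: (e u v); last by rewrite /A uv !mul0r !mulr0 !addr0.
  have := amgm_edge (dpos u v uv) (dpos v u _) l0; rewrite e_sym => /(_ uv).
  by rewrite /A uv !mul1r addrA.
have s2 : \sum_u \sum_v A u v / deg v <= n.
  rewrite exchange_big /=; apply: le_trans sum_edge_inv_deg.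
  by apply: ler_sum => u _; apply: ler_sum => v _; rewrite /A e_sym.
have h1 := ler_wpM2l (exprn_ge0 3 l0) sum_edge_inv_deg.
have h2 := ler_wpM2l (exprn_ge0 3 l0) s2.
have kl : \sum_u \sum_v A u v * (3 * l ^+ 2) = 3 * (m ^+ 3 / n ^+ 2).
  under eq_bigr => u _ do rewrite -mulr_suml.
  by rewrite -mulr_suml -/m /l; field; rewrite gt_eqF.
have ln : l ^+ 3 * n = m ^+ 3 / n ^+ 2 by rewrite /l; field; rewrite gt_eqF.
rewrite -/n ln in h1; rewrite ln in h2; rewrite kl in key; lra.
Qed.

Lemma tc_blakley_roy3_ge0 : 0 <= tc e phi blakley_roy3.
Proof.
have n0 : 0 < #|T|%:R :> R by rewrite ltr0n; apply/card_gt0P; exists (phi 0%N).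
rewrite /tc !big_cons big_nil /= addr0 mul1r mulN1r subr_ge0 tH_path3 tH_matching3.
rewrite !natrX; apply: le_trans (ler_wpM2r _ path3_ge); last first.
  by rewrite invr_ge0 exprn_ge0 ?ltW.
rewrite le_eqVlt; apply/orP; left; apply/eqP; field; rewrite gt_eqF //.
Qed.

End Density.

Lemma blakley_roy3_wf : wfc blakley_roy3.
Proof.
move=> p [<-|[<-|//]] /=; apply/and4P; split => //.
- by apply/forallP => -[[]//|[[|[|[|[|]]]] ?]].
- by apply/forallP => -[[]//|x]; apply/forallP => -[[]//|y]; rewrite /edge /= orbC.
- by apply/forallP => -[[]//|[[|[|[|[|[|[|]]]]]] ?]].
- by apply/forallP => -[[]//|x]; apply/forallP => -[[]//|y]; rewrite /edge /= orbC.
Qed.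

Theorem theorem2p2 :
  exists x : comb, wfc x /\ unlabeled_comb x /\ positive0 x /\ ~ is_sos x.
Proof.
exists blakley_roy3; split; first exact: blakley_roy3_wf.
split; first by move=> p [<-|[<-|[]]].
split; last exact: blakley_roy3_not_sos.
by move=> T e e_sym _ phi; apply: tc_blakley_roy3_ge0.
Qed.
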